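(* Let $R$ be a prime fully bounded noetherian (FBN) ring and suppose that every nonzero two-sided ideal of $R$ contains a nonzero central element of $R$. Then $R$ is a BF-ring.
   Context: Rings are associative with identity. A ring is right (left) bounded if every essential right (left) ideal contains a two-sided ideal that is essential as a right (left) ideal. $R$ is fully bounded noetherian (FBN) if $R$ is left and right noetherian and every prime factor ring $R/P$ is left and right bounded. $R^\bullet$ is the multiplicative monoid of cancellative elements (neither left nor right zero-divisors) of $R$. A nonunit $u\in R^\bullet$ is an atom if $u=ab$ with $a,b\in R^\bullet$ implies that $a$ or $b$ is a unit. $R$ is a BF-ring if every nonunit of $R^\bullet$ is a finite product of atoms of $R^\bullet$ and for every $a\in R^\bullet$ there is $\lambda(a)\in\mathbb{Z}_{\ge 0}$ such that $k\le\lambda(a)$ whenever $a=u_1\cdots u_k$ with atoms $u_i$ of $R^\bullet$. *)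

(* Defs.v *)
From HB Require Import structures.
From mathcomp Require Import all_boot all_algebra.
From mathcomp Require Import boolp classical_sets.

Set Implicit Arguments.
Unset Strict Implicit.
Unset Printing Implicit Defensive.

Import GRing.Theory.
Local Open Scope classical_set_scope.
Local Open Scope ring_scope.

(* Rings are [pzRingType]s: associative, unital, not necessarily commutative,
   and possibly trivial, so that every two-sided ideal has a factor ring. *)

Definition right_ideal (R : pzRingType) (I : set R) : Prop :=
  [/\ I 0, forall x y, I x -> I y -> I (x + y)
    & forall x r, I x -> I (x * r)].

Definition left_ideal (R : pzRingType) (I : set R) : Prop :=
  [/\ I 0, forall x y, I x -> I y -> I (x + y)
    & forall x r, I x -> I (r * x)].

Definition twosided_ideal (R : pzRingType) (I : set R) : Prop :=
  left_ideal I /\ right_ideal I.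

Record ideal (R : pzRingType) := Ideal {
  ideal_set :> set R;
  ideal_twosided : twosided_ideal ideal_set }.

(* MathComp equips [Quotient.quot] with a ring structure only for commutative
   rings. Below, [factor I] is the factor ring of R by a two-sided ideal I: its
   additive group is the one of [Quotient.quot], and its multiplication is
   induced by that of R, see [pi_factor_mul]. *)
Definition ideal_pred (R : pzRingType) (I : ideal R) : {pred R} :=
  fun x => `[< ideal_set I x >].

Lemma ideal_pred_zmod_closed (R : pzRingType) (I : ideal R) :
  zmod_closed (ideal_pred I).
Proof.
have [[I0 ID IMl] _] := ideal_twosided I.
split=> [|x y /asboolP Ix /asboolP Iy].
  exact/asboolP.
by apply/asboolP; apply: ID => //; rewrite -mulN1r; apply: IMl.
Qed.

HB.instance Definition _ (R : pzRingType) (I : ideal R) :=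
  GRing.isZmodClosed.Build R (ideal_pred I) (ideal_pred_zmod_closed I).

Definition factor (R : pzRingType) (I : ideal R) : Type :=
  Quotient.quot (ideal_pred I).

Section Factor.
Local Open Scope quotient_scope.
Variables (R : pzRingType) (I : ideal R).

HB.instance Definition _ := GRing.Zmodule.on (factor I).
HB.instance Definition _ := EqQuotient.on (factor I).

Let piE (x y : R) : reflect (ideal_set I (x - y)) (\pi_(factor I) x == \pi_(factor I) y).
Proof. by rewrite -Quotient.idealrBE; apply: (iffP (asboolP _)). Qed.

Definition factor_one : factor I := \pi_(factor I) 1.
Definition factor_mul (a b : factor I) : factor I :=
  \pi_(factor I) (repr a * repr b).

Lemma pi_factor_mul (x y : R) :
  \pi_(factor I) (x * y) = factor_mul (\pi_(factor I) x) (\pi_(factor I) y).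
Proof.
case: (ideal_twosided I) => -[_ ID IMl] [_ _ IMr]; apply/eqP/piE.
set x' := repr _; set y' := repr _.
have -> : x * y - x' * y' = (x - x') * y + x' * (y - y').
  by rewrite mulrBl mulrBr addrA subrK.
by apply: ID; [apply: IMr | apply: IMl]; apply/piE; rewrite reprK.
Qed.

Lemma pi_factor_add (x y : R) :
  \pi_(factor I) (x + y) = \pi_(factor I) x + \pi_(factor I) y.
Proof. exact: Quotient.pi_add. Qed.

Let factor_mulA : associative factor_mul.
Proof.
elim/quotW=> x; elim/quotW=> y; elim/quotW=> z.
rewrite -(pi_factor_mul y z) -(pi_factor_mul x y).
by rewrite -[LHS]pi_factor_mul -[RHS]pi_factor_mul mulrA.
Qed.

Let factor_mul1 : left_id factor_one factor_mul.
Proof. by elim/quotW=> x; rewrite -[LHS]pi_factor_mul mul1r. Qed.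

Let factor_1mul : right_id factor_one factor_mul.
Proof. by elim/quotW=> x; rewrite -[LHS]pi_factor_mul mulr1. Qed.

Let factor_mulDl : left_distributive factor_mul +%R.
Proof.
elim/quotW=> x; elim/quotW=> y; elim/quotW=> z.
rewrite -(pi_factor_add x y) -(pi_factor_mul x z) -(pi_factor_mul y z).
by rewrite -[LHS]pi_factor_mul -pi_factor_add mulrDl.
Qed.

Let factor_mulDr : right_distributive factor_mul +%R.
Proof.
elim/quotW=> x; elim/quotW=> y; elim/quotW=> z.
rewrite -(pi_factor_add y z) -(pi_factor_mul x y) -(pi_factor_mul x z).
by rewrite -[LHS]pi_factor_mul -pi_factor_add mulrDr.
Qed.

HB.instance Definition _ := GRing.Zmodule_isPzRing.Build (factor I)
  factor_mulA factor_mul1 factor_1mul factor_mulDl factor_mulDr.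

End Factor.

Definition prime_ideal (R : pzRingType) (P : set R) : Prop :=
  [/\ twosided_ideal P, P <> setT
    & forall I J : set R, twosided_ideal I -> twosided_ideal J ->
        (forall x y, I x -> J y -> P (x * y)) -> I `<=` P \/ J `<=` P].

Definition prime_ring (R : pzRingType) : Prop := prime_ideal [set 0 : R].

Definition essential_right (R : pzRingType) (I : set R) : Prop :=
  right_ideal I /\
  forall J : set R, right_ideal J -> J <> [set 0] -> I `&` J <> [set 0].

Definition essential_left (R : pzRingType) (I : set R) : Prop :=
  left_ideal I /\
  forall J : set R, left_ideal J -> J <> [set 0] -> I `&` J <> [set 0].

Definition right_bounded (R : pzRingType) : Prop :=
  forall I : set R, essential_right I ->
    exists J : set R, [/\ twosided_ideal J, essential_right J & J `<=` I].

Definition left_bounded (R : pzRingType) : Prop :=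
  forall I : set R, essential_left I ->
    exists J : set R, [/\ twosided_ideal J, essential_left J & J `<=` I].

Definition right_noetherian (R : pzRingType) : Prop :=
  forall I : nat -> set R, (forall n, right_ideal (I n)) ->
    (forall n, I n `<=` I n.+1) ->
    exists N, forall n, (N <= n)%N -> I n = I N.

Definition left_noetherian (R : pzRingType) : Prop :=
  forall I : nat -> set R, (forall n, left_ideal (I n)) ->
    (forall n, I n `<=` I n.+1) ->
    exists N, forall n, (N <= n)%N -> I n = I N.

Definition FBN (R : pzRingType) : Prop :=
  [/\ left_noetherian R, right_noetherian R
    & forall P : ideal R, prime_ideal P ->
        left_bounded (factor P) /\ right_bounded (factor P)].

Definition central (R : pzRingType) (z : R) : Prop := forall x, GRing.comm z x.

Definition cancellative (R : pzRingType) (a : R) : Prop :=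
  GRing.lreg a /\ GRing.rreg a.

(* Units of R are cancellative, with cancellative inverse, so this is also
   invertibility in the monoid of cancellative elements. *)
Definition is_unit (R : pzRingType) (u : R) : Prop :=
  exists v, u * v = 1 /\ v * u = 1.

Definition atom (R : pzRingType) (u : R) : Prop :=
  [/\ cancellative u, ~ is_unit u
    & forall a b, cancellative a -> cancellative b -> u = a * b ->
        is_unit a \/ is_unit b].

Definition atomic_factorization (R : pzRingType) (a : R) (s : seq R) : Prop :=
  (forall u, u \in s -> atom u) /\ a = \prod_(u <- s) u.

Definition BF_ring (R : pzRingType) : Prop :=
  (forall a : R, cancellative a -> ~ is_unit a ->
     exists s, atomic_factorization a s) /\
  (forall a : R, cancellative a ->
     exists l : nat, forall s, atomic_factorization a s -> (size s <= l)%N).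

(* Main.v *)
Require Import Defs.
From mathcomp Require Import all_boot all_algebra.
From mathcomp Require Import boolp classical_sets.

Set Implicit Arguments.
Unset Strict Implicit.
Unset Printing Implicit Defensive.

Import GRing.Theory.
Local Open Scope classical_set_scope.
Local Open Scope ring_scope.
Local Open Scope quotient_scope.

(** A cancellative element a generates an essential right ideal, which contains
    a nonzero two-sided ideal because R is bounded, hence a nonzero central
    element c = a * b. It is therefore enough to bound the number of nonunits
    u_i in a factorization of the central element c, say with partial products
    x_i = u_1 ... u_i. Since c is central, every factor has a cofactor b_i with
    u_i * b_i = c, and b_i is not in cR if u_i is not a unit. By noetherian
    induction on a right ideal Y containing c, the number of indices with
    b_i not in Y is bounded: a reducible Y is an intersection of two larger right
    ideals, and so only meet-irreducible right ideals E matter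
    ([bounded_count_irreducible]).

    For such an E, let P be the prime annihilator of the small submodules of the
    uniform module R/E, and choose N containing cE, maximal subject to
    N `&` cR = cE. Then R/N is an essential extension of cR/cE, a copy of R/E.
    Let T be the largest two-sided ideal inside N. The chain x_i R + T has
    a bounded number of steps that are not torsion, for a notion of torsion in
    which R/P has only torsion proper quotient rings; and the step at i is not
    torsion if b_i is not in E. Indeed, otherwise left multiplication by u_i
    would be onto up to torsion on R/K, with K the annihilator of R/E, hence
    injective up to torsion by Fitting's argument ([torsion_kernel]), while it
    kills the class of b_i, which generates a submodule without torsion.

    The finiteness of the length of R/T modulo torsion is a form of the theorems
    of Lenagan and Jategaonkar. Torsion is described by a filter F of two-sided
    ideals, a module being torsion if it is annihilated by a member of F. The
    filter is balanced if every bimodule between two ideals of R that is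
    torsion on one side is torsion on the other side. A prime P is critical if
    it is a maximal nonmember of F; modulo P every essential right ideal then
    has torsion quotient, so finitely generated modules over R/P have finite
    length modulo torsion. The extension of F by its critical primes is again
    balanced ([extension_balanced], the analogue of Lenagan's theorem), so that
    a balanced filter that is maximal among those avoiding P has P as a critical
    prime ([critical_filter]). Balanced filters are compatible with essential
    extensions ([essential_torsion], the analogue of Jategaonkar's theorem);
    applied to R/N this puts T into the extension of F, and modules annihilated
    by a member of the extension have finite length modulo torsion
    ([bounded_length_extension]).

    Statements about left ideals are obtained by applying those about right
    ideals to the converse ring R^c. *)

(** * Right ideals and noetherian arguments *)

Lemma not_subsetP {T : Type} {A B : set T} :
  ~ A `<=` B -> exists2 x, A x & ~ B x.
Proof. by move=> /nonsubset[x [Ax nBx]]; exists x. Qed.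

Section RightIdeals.
Variable R : pzRingType.
Implicit Types (A B C X Y Z P I J K : set R).

Lemma right_ideal0 A : right_ideal A -> A 0. Proof. by case. Qed.

Lemma right_idealD A x y : right_ideal A -> A x -> A y -> A (x + y).
Proof. by case=> _ + _; apply. Qed.

Lemma right_idealM A x r : right_ideal A -> A x -> A (x * r).
Proof. by case=> _ _; apply. Qed.

Lemma right_idealB A x y : right_ideal A -> A x -> A y -> A (x - y).
Proof.
move=> iA Ax Ay; rewrite -mulrN1.
by apply: right_idealD => //; apply: right_idealM.
Qed.

Lemma right_ideal_setT : right_ideal [set: R]. Proof. by []. Qed.

Lemma right_ideal_zero : right_ideal [set 0 : R].
Proof. by split=> [|x y -> ->|x r ->] //=; rewrite ?addr0 ?mul0r. Qed.

Lemma right_idealI A B : right_ideal A -> right_ideal B ->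
  right_ideal (A `&` B).
Proof.
move=> iA iB; split=> [|x y [Ax Bx] [Ay By]|x r [Ax Bx]]; split;
  by [apply: right_ideal0|apply: right_idealD|apply: right_idealM].
Qed.

Definition set_sum A B := [set x : R | exists a b, [/\ A a, B b & x = a + b]].

Lemma right_ideal_sum A B : right_ideal A -> right_ideal B ->
  right_ideal (set_sum A B).
Proof.
move=> iA iB; split=> [|x y [a [b [Aa Bb ->]]] [a' [b' [Aa' Bb' ->]]]|x r].
- by exists 0, 0; split; [exact: right_ideal0|exact: right_ideal0|rewrite addr0].
- by exists (a + a'), (b + b'); split;
    [exact: right_idealD|exact: right_idealD|rewrite addrACA].
- move=> [a [b [Aa Bb ->]]]; exists (a * r), (b * r).
  by split; [exact: right_idealM|exact: right_idealM|rewrite mulrDl].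
Qed.

Lemma sub_sumr A B : right_ideal A -> B `<=` set_sum A B.
Proof. by move=> iA b Bb; exists 0, b; rewrite add0r; split=> //; case: iA. Qed.

Lemma sub_suml A B : right_ideal B -> A `<=` set_sum A B.
Proof. by move=> iB a Aa; exists a, 0; rewrite addr0; split=> //; case: iB. Qed.

Lemma sum_sub A B C : right_ideal C -> A `<=` C -> B `<=` C ->
  set_sum A B `<=` C.
Proof.
by move=> iC AC BC _ [a [b [Aa Bb ->]]]; apply: right_idealD; auto.
Qed.

Definition image_mul d A := [set x : R | exists2 r, A r & x = d * r].

Lemma right_ideal_mul d A : right_ideal A -> right_ideal (image_mul d A).
Proof.
move=> iA; split=> [|x y [r Ar ->] [s As ->]|x s [r Ar ->]].
- by exists 0; [exact: right_ideal0|rewrite mulr0].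
- by exists (r + s); [exact: right_idealD|rewrite mulrDr].
- by exists (r * s); [exact: right_idealM|rewrite mulrA].
Qed.

Definition preimage_mul d A := [set r : R | A (d * r)].

Lemma right_ideal_preimage d A : right_ideal A ->
  right_ideal (preimage_mul d A).
Proof.
move=> iA; rewrite /preimage_mul; split=> [|x y Ax Ay|x r Ax] /=.
- by rewrite mulr0; exact: right_ideal0.
- by rewrite mulrDr; exact: right_idealD.
- by rewrite mulrA; exact: right_idealM.
Qed.

(** The ascending chain condition as a choice of maximal members, the form
    that noetherian induction takes below. *)
Lemma noetherian_max (Rn : right_noetherian R) (F : set (set R)) :
  (exists A, F A) -> (forall A, F A -> right_ideal A) ->
  exists2 A, F A & forall B, F B -> A `<=` B -> B `<=` A.
Proof.
move=> [A0 FA0] Fi; apply: contrapT => noM.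
have step (A : {A | F A}) : exists B : {A | F A},
    sval A `<=` sval B /\ ~ sval B `<=` sval A.
  apply: contrapT => noB; apply: noM; exists (sval A); first exact: (svalP A).
  move=> B FB AB; apply: contrapT => nBA.
  by apply: noB; exists (exist _ B FB).
have [f fP] := choice step.
pose g n := iter n f (exist _ A0 FA0).
have [|n|N gN] := Rn (fun n => sval (g n)).
- by move=> n; apply: Fi; exact: (svalP (g n)).
- exact: (fP (g n)).1.
- by apply: (fP (g N)).2; rewrite -[f (g N)]/(g N.+1) (gN N.+1 (leqnSn N)).
Qed.

(** Induction on a finite generating set of X, without naming the generators. *)
Lemma noetherian_ind (Rn : right_noetherian R) (H : set R -> Prop) X :
  right_ideal X -> H [set 0] ->
  (forall A d, right_ideal A -> A `<=` X -> X d -> H A ->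
     H (set_sum A (image_mul d setT))) ->
  H X.
Proof.
move=> iX H0 HS.
(* A maximal member of H inside X absorbs every further generator d. *)
have [|A [iA AX]|A [iA AX HA] maxA] :=
  noetherian_max Rn (F := [set A | [/\ right_ideal A, A `<=` X & H A]]).
- exists [set 0]; split=> // [|_ ->]; first exact: right_ideal_zero.
  exact: right_ideal0.
- by [].
suff -> : X = A by [].
apply/seteqP; split=> // d Xd.
have idT := right_ideal_mul d right_ideal_setT.
apply: (maxA (set_sum A (image_mul d setT))); last first.
- by apply: sub_sumr => //; exists 1; rewrite ?mulr1.
- exact: sub_suml.
- split; [exact: right_ideal_sum| |exact: HS].
  by apply: sum_sub => // _ [r _ ->]; exact: right_idealM.
Qed.

(** The image of Z is an essential submodule of X / Y, expressed inside R so as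
    to avoid quotient modules. *)
Definition essential Y Z X :=
  forall E, right_ideal E -> Y `<=` E -> E `<=` X -> ~ E `<=` Y ->
  exists e, [/\ E e, Z e & ~ Y e].

(** Take C maximal among the right ideals independent, modulo Y, of some member
    V of F. A piece of V independent of a smaller member could be added to C, so
    V is an essential extension of each member below it. With all right ideals
    as F this provides uniform submodules; with two-sided ideals it makes the
    nonzero subbimodules of V right essential. *)
Lemma essential_minimal (Rn : right_noetherian R) Y (F : set (set R)) :
  right_ideal Y -> (exists V, F V) ->
  (forall V, F V -> right_ideal V /\ Y `<=` V) ->
  exists2 V, F V & forall V', F V' -> V' `<=` V -> essential Y V' V.
Proof.
move=> iY [V0 FV0] FY.
have [||C [iC [V [FV VC]]] maxC] := noetherian_max Rn
  (F := [set C | right_ideal C /\ exists V, F V /\ V `&` C `<=` Y]).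
- by exists Y; split=> //; exists V0; split=> // x [].
- by move=> A [].
have [iV _] := FY _ FV.
exists V => // V' FV' V'V E iE YE EV nEY; apply: contrapT => noE.
have [iV' YV'] := FY _ FV'.
apply: nEY => e Ee; apply: (VC); split; first exact: EV.
apply: (maxC (set_sum C E)); last exact: sub_sumr.
- split; first exact: right_ideal_sum.
  exists V'; split=> // v [V'v [c [e' [Cc Ee' ev]]]].
  have Yc : Y c.
    apply: VC; split=> //; rewrite -(addrK e' c) -ev.
    by apply: right_idealB => //; [exact: V'V | exact: EV].
  have V'e' : V' e'.
    by rewrite -(addKr c e') -ev addrC; apply: right_idealB => //; exact: YV'.
  rewrite ev; apply: right_idealD => //; apply: contrapT => nYe'.
  by apply: noE; exists e'.
- exact: sub_suml.
Qed.

End RightIdeals.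

(** * Annihilators, prime ideals and boundedness *)

Section Annihilators.
Variable R : pzRingType.
Implicit Types (A B C X Y Z P I J K : set R).

Lemma left_ideal0 A : left_ideal A -> A 0. Proof. by case. Qed.

Lemma left_idealD A x y : left_ideal A -> A x -> A y -> A (x + y).
Proof. by case=> _ + _; apply. Qed.

Lemma left_idealM A x r : left_ideal A -> A x -> A (r * x).
Proof. by case=> _ _; apply. Qed.

Lemma left_idealB A x y : left_ideal A -> A x -> A y -> A (x - y).
Proof. exact: (@right_idealB R^c). Qed.

Definition rann X Y := [set r : R | forall x, X x -> Y (x * r)].
Definition lann X Y := [set r : R | forall x, X x -> Y (r * x)].

Lemma twosided_rann X Y :
  right_ideal X -> right_ideal Y -> twosided_ideal (rann X Y).
Proof.
move=> iX iY; split; split=> [x Xx|r s Yr Ys x Xx|r s Yr x Xx].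
- by rewrite mulr0; exact: right_ideal0.
- by rewrite mulrDr; apply: right_idealD => //; [exact: Yr|exact: Ys].
- by rewrite mulrA; apply: Yr; exact: right_idealM.
- by rewrite mulr0; exact: right_ideal0.
- by rewrite mulrDr; apply: right_idealD => //; [exact: Yr|exact: Ys].
- by rewrite mulrA; apply: right_idealM => //; exact: Yr.
Qed.

(** Passing to the converse ring exchanges left and right ideals by mere
    unfolding; two-sided and prime ideals are kept. *)
Lemma twosided_conv I : @twosided_ideal R^c I <-> twosided_ideal I.
Proof. by split=> -[]; split. Qed.

Lemma left_ideal_lann X Y : left_ideal Y -> left_ideal (lann X Y).
Proof.
move=> iY; split=> [x _|r s Yr Ys x Xx|r s Yr x Xx].
- by rewrite mul0r; exact: left_ideal0.
- by rewrite mulrDl; apply: left_idealD => //; [exact: Yr|exact: Ys].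
- by rewrite -mulrA; apply: left_idealM => //; exact: Yr.
Qed.

Lemma twosided_lann X Y :
  left_ideal X -> left_ideal Y -> twosided_ideal (lann X Y).
Proof.
move=> lX lY; split; first exact: left_ideal_lann.
have [Y0 YD _] := @left_ideal_lann X Y lY.
split=> // r s Yr x Xx; rewrite -mulrA; apply: Yr; exact: left_idealM.
Qed.

Lemma right_ideal_lann X Y : left_ideal X -> right_ideal Y ->
  right_ideal (lann X Y).
Proof.
move=> lX iY; split=> [x _|r s Yr Ys x Xx|r s Yr x Xx].
- by rewrite mul0r; exact: right_ideal0.
- by rewrite mulrDl; apply: right_idealD => //; [exact: Yr|exact: Ys].
- by rewrite -mulrA; apply: Yr; exact: left_idealM.
Qed.

Lemma twosided_right I : twosided_ideal I -> right_ideal I. Proof. by case. Qed.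

Lemma twosided_left I : twosided_ideal I -> left_ideal I. Proof. by case. Qed.

Lemma twosidedI I J : twosided_ideal I -> twosided_ideal J ->
  twosided_ideal (I `&` J).
Proof.
by move=> [lI rI] [lJ rJ]; split; [exact: (@right_idealI R^c)|exact: right_idealI].
Qed.

Lemma twosided_sum I J : twosided_ideal I -> twosided_ideal J ->
  twosided_ideal (set_sum I J).
Proof.
move=> [lI rI] [lJ rJ].
by split; [exact: (@right_ideal_sum R^c)|exact: right_ideal_sum].
Qed.

Lemma twosided_setT : twosided_ideal [set: R]. Proof. by []. Qed.

Lemma prime_conv P : @prime_ideal R^c P <-> prime_ideal P.
Proof.
split=> -[iP nP pP]; split=> //; try exact/twosided_conv.
- move=> I J iI iJ IJ; apply/or_comm/pP; try exact/twosided_conv.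
  by move=> x y Jx Iy; exact: IJ.
- move=> I J iI iJ IJ; apply/or_comm/pP; try exact/twosided_conv.
  by move=> x y Jx Iy; exact: IJ.
Qed.

Lemma prime_meet P I J : prime_ideal P -> twosided_ideal I -> twosided_ideal J ->
  ~ I `<=` P -> ~ J `<=` P -> ~ I `&` J `<=` P.
Proof.
move=> [_ _ pP] iI iJ nI nJ IJ.
have [] // := pP _ _ iI iJ => x y Ix Jy; apply: IJ; split.
  exact: right_idealM (twosided_right iI) Ix.
exact: (@right_idealM R^c) (twosided_left iJ) Jy.
Qed.

Lemma prime_not_setT P : prime_ideal P -> ~ [set: R] `<=` P.
Proof. by move=> [_ nT _] TP; apply: nT; apply/seteqP; split. Qed.

(** A largest annihilator among the nonzero submodules of X / Y is prime, and the
    submodule U that realizes it shares it with all its nonzero submodules. Only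
    submodules containing N are considered, which lets U / N be formed later. *)
Lemma prime_annihilator N X Y : right_noetherian R ->
  right_ideal N -> right_ideal Y -> right_ideal X ->
  N `<=` Y -> N `<=` X -> ~ X `<=` Y ->
  exists U, [/\ [/\ right_ideal U, N `<=` U, U `<=` X & ~ U `<=` Y],
    prime_ideal (rann U Y)
    & forall V, right_ideal V -> N `<=` V -> V `<=` U -> ~ V `<=` Y ->
        rann V Y `<=` rann U Y].
Proof.
move=> rn iN iY iX NY NX nXY.
pose VV : set (set R) :=
  [set V | [/\ right_ideal V, N `<=` V, V `<=` X & ~ V `<=` Y]].
have [||_ [U VU <-] maxQ] := noetherian_max rn
  (F := [set Q | exists2 V, VV V & rann V Y = Q]).
- by exists (rann X Y); exists X; split=> //; exact: subset_refl.
- by move=> _ [V [iV _ _ _] <-]; case: (twosided_rann iV iY).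
have [iU NU UX nU] := VU.
have sub_max V : VV V -> V `<=` U -> rann V Y `<=` rann U Y.
  move=> VVV VW; apply: maxQ; first by exists V.
  by move=> r Ur x /VW; exact: Ur.
exists U; split=> //; last first.
  by move=> V iV NV VU' nV; apply: sub_max => //; split=> // x /VU' /UX.
split=> [|QT|I J iI iJ IJ]; first exact: twosided_rann.
  have Q1 : rann U Y 1 by rewrite QT.
  by apply: nU => x /Q1; rewrite mulr1.
have [|/not_subsetP[i Ii nUi]] := pselect (I `<=` rann U Y); first by left.
right; move: nUi => /existsNP[w /not_implyP[Uw nwi]].
apply: subset_trans (sub_max (U `&` lann J Y) _ _).
- by move=> j Jj x [_ xJ]; exact: xJ.
- split.
  + by apply: right_idealI => //; exact: right_ideal_lann iJ.1 iY.
  + move=> x Nx; split; first exact: NU.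
    by move=> j _; apply: right_idealM => //; exact: NY.
  + by move=> x [/UX].
  + move=> H; apply: nwi; apply: H; split; first exact: right_idealM.
    by move=> j Jj; rewrite -mulrA; apply: IJ.
- by move=> x [].
Qed.

(** Right boundedness of R / P for a prime ideal P, in terms of ideals of R that
    contain P. *)
Definition bounded_at P := forall V, right_ideal V -> P `<=` V ->
  essential P V setT ->
  exists J, [/\ twosided_ideal J, P `<=` J, ~ J `<=` P & J `<=` V].

(** For a generator d of X, the set of all s with d * s in Z is an essential right
    ideal modulo P, so it contains an ideal that is nonzero modulo P; P being
    prime, the ideals of finitely many generators have an intersection that is
    still nonzero modulo P. *)
Lemma essential_bounded P X Y Z (Rn : right_noetherian R) :
  prime_ideal P -> bounded_at P ->
  right_ideal X -> right_ideal Y -> right_ideal Z ->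
  Y `<=` X -> Y `<=` Z -> (forall x p, X x -> P p -> Y (x * p)) ->
  essential Y Z X ->
  exists J, [/\ twosided_ideal J, P `<=` J, ~ J `<=` P & J `<=` rann X Z].
Proof.
move=> pP bP iX iY iZ YX YZ XP eZ; have [iP _ _] := pP.
apply: (noetherian_ind Rn (H := fun A => exists J,
  [/\ twosided_ideal J, P `<=` J, ~ J `<=` P & J `<=` rann A Z]) iX).
  exists setT; split=> //; first exact: prime_not_setT.
  by move=> r _ _ ->; rewrite mul0r; exact: right_ideal0.
move=> A d iA AX Xd [JA [iJA PJA nJA JAZ]].
have [|||J [iJ PJ nJ JV]] := bP (preimage_mul d Z).
- exact: right_ideal_preimage.
- by move=> p Pp; apply: YZ; exact: XP.
- move=> E iE PE _ nE.
  have [dEY|] := pselect (image_mul d E `<=` Y).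
    have [e Ee nPe] := not_subsetP nE; exists e; split=> //.
    by apply: YZ; apply: dEY; exists e.
  move=> nEY; have idE := right_ideal_mul d iE.
  have [||||z [[_ [y [[s Es ->] Yy ->]]] Zz nYz]] := eZ (set_sum (image_mul d E) Y).
  + exact: right_ideal_sum.
  + exact: sub_sumr.
  + by apply: sum_sub => // _ [s _ ->]; exact: right_idealM.
  + by move=> H; apply: nEY; apply: subset_trans H; exact: sub_suml.
  exists s; split=> //.
    by rewrite /preimage_mul /= -(addrK y (d * s)); apply: right_idealB => //; exact: YZ.
  by move=> Ps; apply: nYz; apply: right_idealD => //; exact: XP.
exists (JA `&` J); split.
- exact: twosidedI.
- by move=> p Pp; split; [exact: PJA|exact: PJ].
- exact: prime_meet.
- move=> r [JAr Jr] _ [a [_ [Aa [s _ ->] ->]]]; rewrite mulrDl.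
  apply: right_idealD => //; first exact: JAZ.
  rewrite -mulrA; apply: JV.
  exact: (@right_idealM R^c) (twosided_left iJ) Jr.
Qed.

End Annihilators.

(** The fully bounded noetherian condition without factor rings, so that passing
    to the converse ring simply exchanges its right and left clauses. *)
Record fbn_ring (R : pzRingType) : Prop := FbnRing {
  fbn_right_noetherian : right_noetherian R;
  fbn_left_noetherian : right_noetherian R^c;
  fbn_right_bounded : forall P : set R, prime_ideal P -> bounded_at P;
  fbn_left_bounded : forall P : set R, prime_ideal P -> @bounded_at R^c P }.

Lemma fbn_conv (R : pzRingType) : fbn_ring R -> fbn_ring R^c.
Proof.
case=> rn ln rb lb; split=> // P pP.
- by apply: lb; exact/prime_conv.
- by apply: rb; exact/prime_conv.
Qed.

(** Boundedness of R / P is pulled back along an epimorphism f with kernel P. An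
    abstract f serves both the factor ring of R and, for the left-hand version,
    the converse of that factor ring, which is not a factor ring of R^c on the
    nose. *)
Lemma bounded_at_epi (R S : pzRingType) (f : R -> S) (P : set R) :
  prime_ideal P ->
  {morph f : x y / x + y} -> {morph f : x y / x * y} ->
  (forall y, exists x, f x = y) -> (forall x, f x = 0 <-> P x) ->
  right_bounded S -> bounded_at P.
Proof.
move=> pP fD fM fS fP bS V iV PV eV; have [[_ iP] _ _] := pP.
have f0 : f 0 = 0 by apply/fP; exact: right_ideal0.
have fN x : f (- x) = - f x.
  by apply/eqP; rewrite -addr_eq0 -fD addNr f0.
have imV x : (f @` V) (f x) -> V x.
  move=> [v Vv fvx]; rewrite -(subrK v x); apply: right_idealD => //.
  by apply: PV; apply/fP; rewrite fD fN fvx subrr.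
have preim (J : set S) : right_ideal J -> right_ideal [set x | J (f x)].
  move=> iJ; split=> [|x y Jx Jy|x r Jx] /=; rewrite ?f0 ?fD ?fM.
  - exact: right_ideal0.
  - exact: right_idealD.
  - exact: right_idealM.
have preim_nz (J : set S) : right_ideal J -> J <> [set 0] ->
    ~ [set x | J (f x)] `<=` P.
  move=> iJ J0 JP; apply: J0; apply/seteqP; split=> [y Jy|_ ->].
    have [x xy] := fS y; move: Jy; rewrite -xy => Jx.
    by apply/fP; exact: JP.
  exact: right_ideal0.
have PJ (J : set S) : right_ideal J -> P `<=` [set x | J (f x)].
  by move=> iJ p /fP /= ->; exact: right_ideal0.
have iT : right_ideal [set: S] by [].
have [|J [[lJ rJ] [_ eJ] JV]] := bS (f @` V).
  split.
    split=> [|_ _ [v Vv <-] [w Vw <-]|_ s [v Vv <-]].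
    - by exists 0 => //; exact: right_ideal0.
    - by exists (v + w); [exact: right_idealD|rewrite fD].
    - have [r <-] := fS s.
      by exists (v * r); [exact: right_idealM|rewrite fM].
  move=> J iJ J0 VJ.
  have [||||e [/= Je Ve nPe]] := eV [set x | J (f x)] => //.
  - exact: preim.
  - exact: PJ.
  - exact: preim_nz.
  apply: nPe; apply/fP.
  suff : [set 0 : S] (f e) by [].
  by rewrite -VJ; split=> //; exists e.
have J0 : J <> [set 0].
  move=> J0; apply: (eJ setT) => //; last by rewrite setIT.
  move=> T0; apply: (prime_not_setT pP) => x _; apply/fP.
  suff : [set 0 : S] (f x) by [].
  by rewrite -T0.
exists [set x | J (f x)]; split.
- split; last exact: preim.
  split=> [|x y Jx Jy|x r Jx] /=; rewrite ?f0 ?fD ?fM.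
  - exact: right_ideal0.
  - exact: right_idealD.
  - exact: (@right_idealM S^c).
- exact: PJ.
- exact: preim_nz.
- by move=> x /JV; exact: imV.
Qed.

Lemma pi_factor_eq0 (R : pzRingType) (I : ideal R) x :
  \pi_(factor I) x = 0 <-> ideal_set I x.
Proof.
have pi0 : \pi_(factor I) 0 = 0.
  by apply: (addrI (\pi_(factor I) 0)); rewrite -pi_factor_add !addr0.
rewrite -pi0; split=> [/eqP|Ix].
  by rewrite -Quotient.idealrBE subr0 => /asboolP.
by apply/eqP; rewrite -Quotient.idealrBE subr0; exact/asboolP.
Qed.

Lemma FBN_fbn_ring (R : pzRingType) : FBN R -> fbn_ring R.
Proof.
move=> [ln rn bd]; split=> // P pP; have [iP _ _] := pP;
  have [lb rb] := bd (Ideal iP) pP.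
- apply: (bounded_at_epi (f := \pi_(factor (Ideal iP))) _ _ _ _ _ rb) => //.
  + exact: pi_factor_add.
  + exact: pi_factor_mul.
  + by move=> y; exists (repr y); rewrite reprK.
  + exact: pi_factor_eq0.
- apply: (@bounded_at_epi R^c (factor (Ideal iP))^c
    (\pi_(factor (Ideal iP)))) => //.
  + exact/prime_conv.
  + exact: (@pi_factor_add R (Ideal iP)).
  + by move=> x y; exact: (@pi_factor_mul R (Ideal iP) y x).
  + by move=> y; exists (repr y); rewrite reprK.
  + exact: (@pi_factor_eq0 R (Ideal iP)).
  + move=> I eI; have [J [tJ eJ JI]] := lb I eI.
    by exists J; split=> //; exact/twosided_conv.
Qed.

(** * Balanced filters of ideals and their critical primes *)

Section Filters.
Variable R : pzRingType.
Implicit Types (A B C E X Y Z P I J K : set R) (F : set (set R)).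

(** Closure under K above a product I J, taken with I = J, contains upward closure
    ([filter_sub]); the product ideal itself never has to be formed. Membership of
    R is kept as a separate condition, so that the union of every chain of
    filters, the empty chain included, is a filter. *)
Definition ideal_filter F := (forall I, F I -> twosided_ideal I) /\
  forall I J K, F I -> F J -> twosided_ideal K ->
    (forall i j, I i -> J j -> K (i * j)) -> F K.

(** For Y inside X: the bimodule X / Y is torsion as a right module if and only if
    it is torsion as a left module. *)
Definition balanced F := forall X Y, twosided_ideal X -> twosided_ideal Y ->
  F (rann X Y) <-> F (lann X Y).

Definition critical F P := [/\ prime_ideal P, ~ F P
  & forall I, twosided_ideal I -> P `<=` I -> ~ I `<=` P -> F I].

(** The filter generated by F and its critical primes: a module is annihilated by
    a member if it has a finite series whose factors are F-torsion or modules
    over R / P with P critical. *)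
Inductive extension F : set R -> Prop :=
| extension_base I : F I -> extension F I
| extension_critical P : critical F P -> extension F P
| extension_mul I J K : extension F I -> extension F J -> twosided_ideal K ->
    (forall i j, I i -> J j -> K (i * j)) -> extension F K.

Lemma filter_sub F I K :
  ideal_filter F -> F I -> twosided_ideal K -> I `<=` K -> F K.
Proof.
move=> [Fi FM] FI iK IK; apply: (FM _ _ _ FI FI iK) => i j Ii _; apply: IK.
exact: right_idealM (twosided_right (Fi _ FI)) Ii.
Qed.

Lemma extension_filter F : ideal_filter F -> ideal_filter (extension F).
Proof.
move=> [Fi _]; split; last exact: extension_mul.
by move=> I; elim=> [J /Fi|P [[]]|].
Qed.

(** The main step of the analogue of Lenagan's theorem: a bimodule X / Y that is
    annihilated by a critical prime P on the right is annihilated by a member of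
    the extension on the left. A maximal Y for which this fails is fixed. Every
    nonzero subbimodule V / Y then also fails, for otherwise V would be a larger
    counterexample than Y. Among these, X2 / Y is chosen such that all its
    nonzero subbimodules are right essential and have the same left annihilator
    Q, a prime ideal. The point is that Q is critical unless it is in F: for
    an ideal J larger than Q, the left module R / J has a finite filtration with
    factors isomorphic to quotients of cyclic submodules A d of X2 / Y, which
    are torsion because they kill the essential submodule (J `&` A) d. *)
Lemma critical_lann F P X Y : fbn_ring R ->
  ideal_filter F -> F setT -> balanced F -> critical F P ->
  twosided_ideal X -> twosided_ideal Y ->
  (forall x p, X x -> P p -> Y (x * p)) ->
  extension F (lann X Y).
Proof.
move=> [rn ln rb lb] fF FT bF [pP nFP cP] iX.
have fG := extension_filter fF.
have [Fi FM] := fF.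
have [iP _ _] := pP.
have [lX rX] := iX.
wlog : Y / Y `<=` X.
  move=> main iY XP; have [lY rY] := iY.
  apply: filter_sub fG (main (Y `&` X) _ _ _) _ _; first by move=> x [].
  - exact: twosidedI.
  - by move=> x p Xx Pp; split; [exact: XP|exact: right_idealM].
  - exact: twosided_lann.
  - by move=> r Xr x /Xr[].
rename Y into Y1; move=> Y1X iY1 XP1; apply: contrapT => nG1.
have [||Y [iY YX XP nG] maxY] := noetherian_max rn (F :=
  [set Y | [/\ twosided_ideal Y, Y `<=` X, forall x p, X x -> P p -> Y (x * p)
    & ~ extension F (lann X Y)]]).
- by exists Y1.
- by move=> A [[]].
have [lY rY] := iY.
pose VV : set (set R) :=
  [set V | [/\ twosided_ideal V, Y `<=` V, V `<=` X & ~ V `<=` Y]].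
have noG V : VV V -> ~ extension F (lann V Y).
  move=> [iV YV VX nVY] GV; have GX : extension F (lann X V).
    apply: contrapT => nGX; apply: nVY; apply: (maxY) => //; split=> //.
    by move=> x p Xx Pp; apply: YV; exact: XP.
  apply: nG; apply: extension_mul GV GX _ _; first exact: twosided_lann.
  by move=> r s Vr Vs x Xx; rewrite -mulrA; apply: Vr; exact: Vs.
have [|V [[_ rV] YV _ _] //|X1 VX1 essX1] := essential_minimal rn (Y := Y) (F := VV) rY.
  exists X; split=> // XY; apply: nG; apply: extension_base.
  apply: filter_sub fF FT (twosided_lann lX lY) _ => r _ x Xx; apply: XY.
  exact: left_idealM.
have [||_ [X2 [VX2 X21 <-]] maxQ] := noetherian_max rn
  (F := [set Q | exists V, [/\ VV V, V `<=` X1 & lann V Y = Q]]).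
- by exists (lann X1 Y); exists X1; split=> //; exact: subset_refl.
- by move=> _ [V [[[lV _] _ _ _] _ <-]]; case: (twosided_lann lV lY).
have [iX2 YX2 X2X nX2] := VX2.
have [lX2 rX2] := iX2.
set Q := lann X2 Y in maxQ.
have iQ : twosided_ideal Q by exact: twosided_lann.
(* As a left module over R / Q, X2 / Y has no torsion. *)
have tf J' d : twosided_ideal J' -> ~ J' `<=` Q -> X2 d ->
    (forall j, J' j -> Y (j * d)) -> Y d.
  move=> iJ' nJ' X2d J'd; apply: contrapT => nYd; apply: nJ'.
  have [lJ' rJ'] := iJ'.
  pose V := X2 `&` rann J' Y.
  have VV_V : VV V.
    split=> [||x [/X2X]|] //.
    - by apply: twosidedI => //; exact: twosided_rann.
    - move=> y Yy; split; first exact: YX2.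
      by move=> j _; exact: left_idealM.
    - by move=> VY; apply: nYd; apply: VY.
  apply: subset_trans (maxQ (lann V Y) _ _).
  - by move=> j Jj x [_ Vx]; exact: Vx.
  - by exists V; split=> // x [/X21].
  - by move=> r Qr x [/Qr].
have notQ J' : ~ J' `<=` Q -> exists j x, [/\ J' j, X2 x & ~ Y (j * x)].
  move=> /not_subsetP[j Jj /existsNP[x /not_implyP[X2x nY]]].
  by exists j, x.
have pQ : prime_ideal Q.
  split=> // [QT|I J iI iJ IJ].
    have Q1 : Q 1 by rewrite QT.
    by apply: nX2 => x /Q1; rewrite mul1r.
  have [|nI] := pselect (I `<=` Q); first by left.
  right; apply: contrapT => /notQ[j [x [Jj X2x nYjx]]].
  apply: nYjx; apply: (tf I) => //; first exact: left_idealM.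
  by move=> i Ii; rewrite mulrA; exact: IJ.
apply: (noG X2) => //.
have [FQ|nFQ] := pselect (F Q); first exact: extension_base.
apply: extension_critical; split=> // J iJ QJ nJQ.
have [lJ rJ] := iJ.
(* If V contains J' X2, it contains a subbimodule Z which is right essential in
   X2, so X2 / Z is torsion on the right because P is critical, and then on the
   left by balance. *)
have torsion J' V : twosided_ideal J' -> ~ J' `<=` Q -> left_ideal V ->
    Y `<=` V -> J' `<=` lann X2 V -> F (lann X2 V).
  move=> iJ' nJ' lV YV J'V.
  pose Z := X2 `&` lann setT V.
  have iZ : twosided_ideal Z by apply: twosidedI => //; exact: twosided_lann.
  have ZX2 : Z `<=` X2 by move=> x [].
  have VVZ : VV Z.
    split=> //.
    - move=> y Yy; split; first exact: YX2.
      by move=> r _; apply: YV; exact: right_idealM.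
    - exact: subset_trans X2X.
    - have [j [x [Jj X2x nY]]] := notQ _ nJ'.
      move=> ZY; apply: nY; apply: ZY; split; first exact: left_idealM.
      by move=> r _; rewrite -mulrA; apply: J'V => //; exact: right_idealM.
  have [_ YZ _ _] := VVZ; have [lZ rZ] := iZ.
  have eZ : essential Y Z X2.
    move=> E iE YE EX2; apply: essX1 => //; apply: subset_trans X21 => //.
  have [|J3 [iJ3 PJ3 nJ3 J3Z]] :=
    essential_bounded rn pP (rb P pP) rX2 rY rZ YX2 YZ _ eZ.
    by move=> x p /X2X Xx Pp; exact: XP.
  have FZ : F (rann X2 Z).
    by apply: filter_sub fF (cP J3 iJ3 PJ3 nJ3) _ J3Z; exact: twosided_rann.
  apply: filter_sub fF ((bF _ _ iX2 iZ).1 FZ) _ _; first exact: twosided_lann.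
  by move=> r Zr x /Zr[_ /(_ 1 I)]; rewrite mulr1.
(* The left annihilator of E / Y decreases from R to Q as E grows from 0 to X2;
   torsion of its quotient modulo J is carried back from E = X2, where it is
   trivial, to E = 0. *)
suff : F (lann (lann X2 Y) J) -> F J.
  apply; apply: filter_sub fF FT (twosided_lann iQ.1 lJ) _ => r _ x Qx.
  by apply: left_idealM => //; exact: QJ.
apply: (noetherian_ind rn (H := fun E => F (lann (lann E Y) J) -> F J) rX2).
  move=> F0; apply: filter_sub fF F0 iJ _ => r /(_ 1); rewrite mulr1; apply.
  by move=> _ ->; rewrite mulr0; exact: left_ideal0.
move=> E d iE EX2 X2d HE; set E' := set_sum _ _ => FE'; apply: HE.
set A := lann E Y; set A' := lann E' Y in FE'.
have lA : left_ideal A by exact: left_ideal_lann.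
pose Ad : set R := @image_mul R^c d A.
have AdX2 : Ad `<=` X2 by move=> _ [a _ ->]; exact: (left_idealM _ lX2).
(* The image of J `&` A in the cyclic left module Ad is essential; a complement
   C of Ad makes V essential in all of X2, where boundedness applies. *)
have [||C [lC YC CX2 CAd] maxC] := noetherian_max ln
  (F := [set C | [/\ left_ideal C, Y `<=` C, C `<=` X2 & C `&` Ad `<=` Y]]).
- by exists Y; split=> // x [].
- by move=> B [].
pose V : set R := @set_sum R^c (@image_mul R^c d (J `&` A)) C.
have lV : left_ideal V.
  apply: (@right_ideal_sum R^c) => //; apply: (@right_ideal_mul R^c).
  exact: (@right_idealI R^c).
have CV : C `<=` V.
  apply: (@sub_sumr R^c); apply: (@right_ideal_mul R^c).
  exact: (@right_idealI R^c).
have YV : Y `<=` V by exact: subset_trans CV.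
have eV : @essential R^c Y V X2.
  move=> E1 lE1 YE1 E1X2 /not_subsetP[e0 E1e0 nYe0].
  have [E1C|nE1C] := pselect (E1 `<=` C).
    by exists e0; split=> //; apply: CV; exact: E1C.
  apply: contrapT => noe; apply: nE1C.
  have {}noe (c e a : R) : C c -> E1 e -> A a -> c + e = a * d -> Y (c + e).
    move=> Cc E1e Aa cead; apply: contrapT => nYce; apply: noe.
    have [j Jj nYj] : exists2 j, J j & ~ Y (j * (c + e)).
      apply: contrapT => noj; apply: nYce; apply: (tf J) => //.
        by apply: left_idealD => //; [exact: CX2|exact: E1X2].
      by move=> j Jj; apply: contrapT => nY; apply: noj; exists j.
    have jce : j * e = j * a * d - j * c.
      by rewrite -mulrA -cead mulrDr addrAC subrr add0r.
    pose je : R := j * e; pose ja : R := j * a.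
    pose jad : R := ja * d; pose jc : R := - (j * c).
    exists je; split; first exact: (@left_idealM R E1 e j lE1).
    - exists jad, jc; split=> //.
        exists ja => //; split; first exact: (right_idealM a rJ).
        exact: (left_idealM j lA).
      by rewrite /jc -mulNr; exact: (left_idealM (- j) lC).
    - move=> Yje; apply: nYj; apply: CAd; split.
        rewrite mulrDr; apply: left_idealD => //; last exact: YC.
        exact: left_idealM.
      by exists ja; [exact: (left_idealM j lA)|rewrite cead mulrA].
  apply: subset_trans (maxC (@set_sum R^c C E1) _ _).
  - exact: (@sub_sumr R^c).
  - split; first exact: (@right_ideal_sum R^c).
    + exact: subset_trans YC (@sub_suml R^c C E1 lE1).
    + exact: (@sum_sub R^c).
    + by move=> _ [[c [e [Cc E1e ->]]] [a Aa cead]]; exact: (noe c e a).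
  - exact: (@sub_suml R^c C E1 lE1).
have [|J' [/twosided_conv iJ' QJ' nJ' J'V]] :=
  @essential_bounded R^c Q X2 Y V ln ((prime_conv Q).2 pQ) (lb Q pQ)
    lX2 lY lV YX2 YV _ eV.
  by move=> x q X2x Qq; exact: Qq.
have FV : F (lann X2 V) by exact: torsion iJ' nJ' lV YV J'V.
apply: FM FE' FV (twosided_lann lA lJ) _ => i r A'i Vr a Aa.
have [|_ [c [[j [Jj Aj] ->] Cc rad]]] := Vr (a * d); first exact: left_idealM.
have {}rad : (r * a - j) * d = c.
  by apply/eqP; rewrite mulrBl -mulrA subr_eq [c + _]addrC; exact/eqP.
have Ab : A (r * a - j) := left_idealB lA (left_idealM r lA Aa) Aj.
have Ybd : Y ((r * a - j) * d).
  by apply: CAd; split; [rewrite rad|exists (r * a - j : R)].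
rewrite -mulrA -(subrK j (r * a)) mulrDr; apply: left_idealD => //; last first.
  exact: left_idealM.
apply: A'i => _ [e [_ [Ee [s _ ->] ->]]]; rewrite mulrDr.
apply: left_idealD => //; first exact: Ab.
by rewrite mulrA; exact: right_idealM.
Qed.

End Filters.

Section ExtensionConverse.
Variable R : pzRingType.
Implicit Types (A B C E X Y Z P I J K : set R) (F : set (set R)).

Lemma filter_conv F : ideal_filter F -> @ideal_filter R^c F.
Proof.
move=> [Fi FM]; split=> [I FI|I J K FI FJ iK IJK].
  by apply/twosided_conv; exact: Fi.
by apply: (FM J I) => //; [exact/twosided_conv|move=> j i Jj Ii; exact: IJK].
Qed.

Lemma balanced_conv F : balanced F -> @balanced R^c F.
Proof.
move=> bF X Y iX iY; apply: iff_sym; apply: bF; exact/twosided_conv.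
Qed.

Lemma critical_conv F P : critical F P -> @critical R^c F P.
Proof.
move=> [pP nFP cP]; split=> //; first exact/prime_conv.
by move=> I iI; apply: cP; exact/twosided_conv.
Qed.

Lemma critical_conv_inv F P : @critical R^c F P -> critical F P.
Proof.
move=> [pP nFP cP]; split=> //; first exact/prime_conv.
by move=> I iI; apply: cP; exact/twosided_conv.
Qed.

(** Both implications are proved by induction, since R^c^c is convertible to R only
    after its operations are unfolded. *)
Lemma extension_conv F K : @extension R^c F K <-> extension F K.
Proof.
split; elim=> [I FI|P cP|I J L _ GI _ GJ iL IJL]; try exact: extension_base.
- exact: extension_critical (critical_conv_inv cP).
- apply: extension_mul GJ GI _ _; first exact/twosided_conv.
  by move=> j i Jj Ii; exact: IJL.
- exact: extension_critical (critical_conv cP).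
- apply: extension_mul GJ GI _ _; first exact/twosided_conv.
  by move=> j i Jj Ii; exact: IJL.
Qed.

(** By induction on membership in the extension; for a product I J the bimodule
    X / Y is cut at the largest ideal that J sends into Y. *)
Lemma extension_lann F K X Y : fbn_ring R ->
  ideal_filter F -> F setT -> balanced F -> extension F K ->
  twosided_ideal X -> twosided_ideal Y ->
  (forall x k, X x -> K k -> Y (x * k)) -> extension F (lann X Y).
Proof.
move=> fR fF FT bF GK.
elim: GK X Y => {K} [K FK|P cP|I J K _ IHI GJ IHJ iK IJK] X Y iX iY XK.
- apply: extension_base; apply/(bF X Y iX iY).
  apply: filter_sub fF FK (twosided_rann iX.2 iY.2) _ => k Kk x Xx.
  exact: XK.
- exact: critical_lann cP iX iY XK.
- have iJ := (extension_filter fF).1 _ GJ.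
  have iX' : twosided_ideal (lann J Y) by exact: twosided_lann iJ.1 iY.1.
  have GI' : extension F (lann X (lann J Y)).
    apply: IHI => // x i Xx Ii j Jj; rewrite -mulrA; apply: XK => //.
    exact: IJK.
  have GJ' : extension F (lann (lann J Y) Y) by apply: IHJ => // x j; exact.
  apply: extension_mul GJ' GI' (twosided_lann iX.1 iY.1) _.
  by move=> r s Yr Ys x Xx; rewrite -mulrA; apply: Yr; exact: Ys.
Qed.

End ExtensionConverse.

Section Extension.
Variable R : pzRingType.
Implicit Types (A B C E X Y Z P I J K : set R) (F : set (set R)).

(** The analogue of Lenagan's theorem. *)
Lemma extension_balanced F : fbn_ring R ->
  ideal_filter F -> F setT -> balanced F -> balanced (extension F).
Proof.
move=> fR fF FT bF X Y iX iY; split=> GXY.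
  by apply: (extension_lann fR fF FT bF GXY) => // x k Xx; exact.
apply/extension_conv.
apply: (@extension_lann R^c F (lann X Y) X Y (fbn_conv fR) (filter_conv fF)
  FT (balanced_conv bF)); try exact/twosided_conv.
- exact/extension_conv.
- by move=> x k Xx; exact.
Qed.

Lemma extension_prime F K Q :
  ideal_filter F -> extension F K -> prime_ideal Q -> K `<=` Q ->
  exists2 K', F K' \/ critical F K' & K' `<=` Q.
Proof.
move=> fF GK pQ; have gi := (extension_filter fF).1.
elim: GK => [I FI|P cP|I J L GI IHI GJ IHJ iL IJL] KQ.
- by exists I; [left|].
- by exists P; [right|].
- have [_ _ prQ] := pQ.
  by have [x y Ix Jy|/IHI|/IHJ] := prQ I J (gi _ GI) (gi _ GJ) => //;
    apply: KQ; exact: IJL.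
Qed.

Lemma filter_setT : ideal_filter [set [set: R]].
Proof.
split=> [I ->|I J K -> -> iK IJK]; first exact: twosided_setT.
by apply/seteqP; split=> // x _; rewrite -(mulr1 x); exact: IJK.
Qed.

Lemma balanced_setT : balanced [set [set: R]].
Proof.
move=> X Y iX iY; split=> /= H; apply/seteqP; split=> // r _ x Xx.
- have : rann X Y 1 by rewrite H.
  by move=> /(_ x Xx); rewrite mulr1; exact: left_idealM iY.1.
- have : lann X Y 1 by rewrite H.
  by move=> /(_ x Xx); rewrite mul1r; exact: right_idealM iY.2.
Qed.

(** Let F be maximal among the balanced filters avoiding P. A maximal ideal outside
    F above P is prime and critical, so the extension of F is balanced and
    strictly larger, hence contains P. Therefore P lies above a critical prime,
    and is equal to it because ideals strictly above critical primes are in F. *)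
Lemma critical_filter P : fbn_ring R -> prime_ideal P ->
  exists F, [/\ ideal_filter F, F setT, balanced F & critical F P].
Proof.
move=> fR pP; have [iP nP _] := pP.
pose good F := [/\ ideal_filter F, balanced F & ~ F P].
have [|F [[fF bF nFP] maxF]] := @Zorn_bigcup _ good.
  move=> CC Cgood Ctot; split.
  - split=> [I [F CF FI]|I J K [F CF FI] [F' CF' FJ] iK IJK].
      by have [[Fi _] _ _] := Cgood _ CF; exact: Fi.
    have [FF'|F'F] := Ctot _ _ CF CF'.
      have [[_ FM] _ _] := Cgood _ CF'.
      by exists F' => //; exact: FM (FF' _ FI) FJ iK IJK.
    have [[_ FM] _ _] := Cgood _ CF.
    by exists F => //; exact: FM FI (F'F _ FJ) iK IJK.
  - move=> X Y iX iY; split=> -[F CF FXY]; exists F => //;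
      have [_ bF _] := Cgood _ CF; exact/(bF X Y iX iY).
  - by move=> [F CF]; have [_ _] := Cgood _ CF.
have [Fi FM] := fF.
have large F' : good F' -> F `<=` F' -> F' `<=` F.
  move=> gF' FF'; apply: contrapT => nF'F; apply: (maxF F' _ gF').
  by split.
have FT : F setT.
  have [[I FI]|noF] := pselect (exists I, F I).
    by apply: filter_sub fF FI _ _ => //; exact: twosided_setT.
  apply: (large [set setT]) => //; last by move=> I FI; case: noF; exists I.
  by split; [exact: filter_setT|exact: balanced_setT|].
exists F; split=> //.
have GP : extension F P.
  apply: contrapT => nGP.
  have [||M [iM PM nFM] maxM] := noetherian_max (fbn_right_noetherian fR)
    (F := [set M | [/\ twosided_ideal M, P `<=` M & ~ F M]]).
  - by exists P; split=> //; exact: subset_refl.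
  - by move=> A [[]].
  have bigger I : twosided_ideal I -> M `<=` I -> ~ I `<=` M -> F I.
    move=> iI MI nIM; apply: contrapT => nFI; apply: nIM; apply: maxM => //.
    by split=> //; exact: subset_trans MI.
  apply: (nFM); apply: (large (extension F)).
  - split=> //; [exact: extension_filter|exact: extension_balanced].
  - by move=> I FI; exact: extension_base.
  apply: extension_critical; split=> //; split=> // [MT|I J iI iJ IJ].
    by apply: nFM; rewrite MT.
  apply: contrapT => /not_orP[nI nJ].
  have FMI L : twosided_ideal L -> ~ L `<=` M -> F (set_sum M L).
    move=> iL nL; apply: bigger; first exact: twosided_sum.
      exact: sub_suml iL.2.
    by move=> H; apply: nL; apply: subset_trans H; exact: sub_sumr iM.2.
  apply: nFM; apply: FM (FMI I iI nI) (FMI J iJ nJ) (iM) _.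
  move=> _ _ [m [x [Mm Ix ->]]] [m' [y [Mm' Jy ->]]].
  rewrite mulrDl [x * _]mulrDr; apply: (right_idealD iM.2).
    by apply: right_idealM iM.2 Mm.
  apply: (right_idealD iM.2); first exact: left_idealM iM.1 Mm'.
  exact: IJ.
have [K [FK|cK] KP] := extension_prime fF GP pP (@subset_refl _ P).
  by case: nFP; exact: filter_sub fF FK iP KP.
suff -> : P = K by [].
apply/seteqP; split=> //; apply: contrapT => nPK; apply: nFP.
by have [_ _] := cK; apply.
Qed.

(** The analogue of Jategaonkar's theorem: an essential extension X / N of a
    G-torsion module W / N is G-torsion. Otherwise let W1 / N be the largest
    torsion submodule and let W2 / W1 have prime annihilator Q as in
    [prime_annihilator]. If T is the annihilator of W2 / N, then the bimodule of
    Q modulo T is torsion on the right, hence on the left: J Q lies in T for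
    some J in G. Now W2 J modulo N is a module over R / Q, not contained in W1
    since J is not in Q. As R / Q is bounded and W1 cuts out an essential
    submodule of it, its quotient by that submodule has an annihilator strictly
    above Q, contrary to the choice of W2. *)
Lemma essential_torsion (G : set (set R)) N X W : fbn_ring R ->
  ideal_filter G -> G setT -> balanced G ->
  right_ideal N -> right_ideal X -> right_ideal W ->
  N `<=` W -> W `<=` X -> essential N W X ->
  G (rann W N) -> G (rann X N).
Proof.
move=> fR fG GT bG iN iX iW NW WX eW GW.
have [rn ln rb lb] := fR.
apply: contrapT => nGX.
have [||W1 [iW1 WW1 W1X GW1] maxW1] := noetherian_max rn (F :=
  [set V | [/\ right_ideal V, W `<=` V, V `<=` X & G (rann V N)]]).
- by exists W; split=> //; exact: subset_refl.
- by move=> A [].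
have nXW1 : ~ X `<=` W1.
  move=> XW1; apply: nGX; suff -> : X = W1 by [].
  by apply/seteqP.
have NW1 : N `<=` W1 by exact: subset_trans WW1.
have NX : N `<=` X by exact: subset_trans W1X.
have [W2 [[iW2 NW2 W2X nW2] pQ sub_max]] :=
  prime_annihilator rn iN iW1 iX NW1 NX nXW1.
set Q := rann W2 W1 in pQ sub_max.
have iQ : twosided_ideal Q by exact: twosided_rann.
have nGQ : ~ G Q.
  move=> GQ; apply: nW2; apply: subset_trans (maxW1 (set_sum W1 W2) _ _).
  - exact: sub_sumr.
  - have iS := right_ideal_sum iW1 iW2.
    split=> //; first exact: subset_trans (sub_suml iW2).
      exact: sum_sub.
    apply: fG.2 GQ GW1 (twosided_rann iS iN) _.
    move=> q i Qq W1i _ [w1 [w2 [Ww1 Ww2 ->]]]; rewrite mulrA mulrDl.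
    apply: W1i; apply: right_idealD => //; first exact: right_idealM.
    exact: Qq.
  - exact: sub_suml.
pose T := rann W2 N.
have iT : twosided_ideal T by exact: twosided_rann.
have GJ : G (lann Q T).
  apply/(bG Q T iQ iT); apply: filter_sub fG GW1 (twosided_rann iQ.2 iT.2) _.
  by move=> i W1i q Qq x W2x; rewrite mulrA; apply: W1i; exact: Qq.
have nJQ : ~ lann Q T `<=` Q.
  by move=> JQ; apply: nGQ; exact: filter_sub fG GJ iQ JQ.
pose W' := W2 `&` lann Q N.
have iW' : right_ideal W'.
  by apply: right_idealI => //; exact: right_ideal_lann iQ.1 iN.
have NW' : N `<=` W'.
  move=> x Nx; split; first exact: NW2.
  by move=> q _; exact: right_idealM.
have nW' : ~ W' `<=` W1.
  move=> W'W1; apply: nJQ => j Jj w W2w; apply: W'W1.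
  split; first exact: right_idealM.
  by move=> q Qq; rewrite -mulrA; apply: Jj.
have eW' : essential N (W' `&` W1) W'.
  move=> E iE NE EW' nEN.
  have [|e [Ee We nNe]] := eW E iE NE _ nEN.
    by move=> x /EW' [/W2X].
  by exists e; split=> //; split; [exact: EW'|exact: WW1].
have [||J [_ _ nJ JW]] := essential_bounded rn pQ (rb Q pQ) iW' iN
  (right_idealI iW' iW1) NW' _ _ eW'.
- by move=> x Nx; split; [exact: NW'|exact: NW1].
- by move=> x q [_ W'x] Qq; exact: W'x.
apply: nJ; apply: subset_trans (sub_max W' iW' NW' _ nW'); last by move=> x [].
by move=> j Jj x W'x; have [] := JW j Jj x W'x.
Qed.

End Extension.

(** * Length modulo torsion *)

Section Length.
Variable R : pzRingType.
Implicit Types (A B C E X Y Z P I J K : set R) (F : set (set R)).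

(** X / Y has finite length in the quotient of the category of modules by F-torsion.
    Steps with torsion factors are allowed in the chains, because one and the
    same chain of partial products is measured with respect to several
    filters. *)
Definition bounded_length F X Y := exists n, forall k (f : nat -> set R),
  (forall i, right_ideal (f i)) -> (forall i, f i.+1 `<=` f i) ->
  (forall i, Y `<=` f i /\ f i `<=` X) ->
  (\sum_(i < k) `[< ~ F (rann (f i) (f i.+1)) >] <= n)%N.

Lemma bounded_length_torsion F I X Y : ideal_filter F -> F I ->
  (forall x i, X x -> I i -> Y (x * i)) -> bounded_length F X Y.
Proof.
move=> fF FI XI; exists 0%N => k f fi fS fb.
rewrite big1 // => i _; apply/eqP; rewrite eqb0; apply/asboolPn; apply.
apply: filter_sub fF FI (twosided_rann (fi _) (fi _)) _ => r Ir x fx.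
by apply: (fb _).1; apply: XI => //; exact: (fb _).2 fx.
Qed.

(** A step that is torsion both after intersecting with Z and after adding Z is
    torsion. *)
Lemma bounded_length_trans F X Y Z : ideal_filter F ->
  right_ideal X -> right_ideal Z -> Z `<=` X -> Y `<=` Z ->
  bounded_length F X Z -> bounded_length F Z Y -> bounded_length F X Y.
Proof.
move=> fF iX iZ ZX YZ [n Xn] [m Zm]; exists (n + m)%N => k f fi fS fb.
have := Xn k (fun i => set_sum (f i) Z).
have := Zm k (fun i => f i `&` Z).
move=> /(_ _ _ _)-Hm /(_ _ _ _)-Hn.
apply: leq_trans (leq_add (Hn _ _ _) (Hm _ _ _)) => [|i|i|i|i|i|i].
- rewrite -big_split /=; apply: leq_sum => i _.
  set a := `[< _ >]; set b := `[< _ >]; set c := `[< _ >].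
  suff : ~~ b -> ~~ c -> ~~ a by case: a; case: b; case: c => // /(_ isT isT).
  move=> /asboolPn/contrapT Fb /asboolPn/contrapT Fc.
  apply/asboolPn; apply; apply: fF.2 Fb Fc (twosided_rann (fi _) (fi _)) _.
  move=> r s br cs x fx; rewrite mulrA.
  have [|y [z [fy Zz e]]] := br x; first exact: sub_suml fx.
  rewrite e mulrDl; apply: right_idealD => //; first exact: right_idealM.
  have [] // := cs z; split=> //.
  rewrite -(addKr y z) -e addrC; apply: right_idealB => //; last exact: fS.
  exact: right_idealM.
- exact: right_ideal_sum.
- by apply: sum_sub; [exact: right_ideal_sum|
    exact: subset_trans (fS i) (sub_suml iZ)|exact: sub_sumr].
- split; first exact: sub_sumr.
  by apply: sum_sub => //; exact: (fb i).2.
- exact: right_idealI.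
- by move=> x [/fS].
- by split=> x; [move=> Yx; split; [exact: (fb i).1|exact: YZ]|case].
Qed.

(** A uniform module over R / P, with P critical, has length one, since each of its
    nonzero submodules is essential and so has a torsion quotient. *)
Lemma bounded_length_critical F P X Y : fbn_ring R ->
  ideal_filter F -> F setT -> critical F P ->
  right_ideal X -> right_ideal Y -> Y `<=` X ->
  (forall x p, X x -> P p -> Y (x * p)) -> bounded_length F X Y.
Proof.
move=> [rn _ rb _] fF FT [pP _ cP] iX iY YX XP.
have [||Z [iZ YZ ZX bZ] maxZ] := noetherian_max rn (F :=
  [set Z | [/\ right_ideal Z, Y `<=` Z, Z `<=` X & bounded_length F Z Y]]).
- exists Y; split=> //; try exact: subset_refl.
  apply: (bounded_length_torsion fF FT) => x i Yx _; exact: right_idealM.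
- by move=> A [].
have [XZ|nXZ] := pselect (X `<=` Z).
  by suff -> : X = Z by []; apply/seteqP.
pose VV : set (set R) :=
  [set V | [/\ right_ideal V, Z `<=` V, V `<=` X & ~ V `<=` Z]].
have [|V []|U [iU ZU UX nU] eU] := essential_minimal rn (F := VV) iZ => //.
  by exists X; split=> //; exact: subset_refl.
case: nU; apply: maxZ => //; split=> //; first exact: subset_trans ZU.
apply: (bounded_length_trans fF iU iZ ZU YZ) => //.
exists 1%N => k f fi fS fb.
have torsion i : f i.+1 `<=` Z \/ F (rann (f i) (f i.+1)).
  have [|nf] := pselect (f i.+1 `<=` Z); [by left|right].
  have [||J [iJ PJ nJ JU]] := essential_bounded rn pP (rb P pP) iU iZ (fi i.+1)
    ZU (fb _).1 _ (eU (f i.+1) _ (fb _).2).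
  - by move=> x p Ux Pp; apply: YZ; apply: XP => //; exact: UX.
  - split=> //; first exact: (fb _).1.
    by move=> x /(fb _).2 /UX.
  apply: filter_sub fF (cP J iJ PJ nJ) (twosided_rann (fi _) (fi _)) _.
  by move=> j Jj x /(fb _).2 Ux; exact: JU.
(* Only the step at which the chain reaches Z can be nontorsion; the summand for
   f k records whether this step is still to come. *)
suff : (\sum_(i < k) `[< ~ F (rann (f i) (f i.+1)) >] +
        `[< ~ f k `<=` Z >] <= 1)%N by apply: leq_trans; exact: leq_addr.
elim: k => [|k IH]; first by rewrite big_ord0; case: `[< _ >].
apply: leq_trans IH; rewrite big_ord_recr /= -addnA leq_add2l.
have [fkZ|nfkZ] := pselect (f k `<=` Z).
  have fk1Z : f k.+1 `<=` Z by exact: subset_trans (fS k) fkZ.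
  have -> : `[< ~ f k.+1 `<=` Z >] = false by apply: asboolF; apply.
  suff -> : `[< ~ F (rann (f k) (f k.+1)) >] = false by [].
  apply: asboolF; apply.
  apply: filter_sub fF FT (twosided_rann (fi _) (fi _)) _ => r _ x fx.
  by apply: (fb _).1; apply: fkZ; exact: right_idealM.
rewrite [X in (_ <= nat_of_bool X)%N]asboolT //.
have [fk1Z|Fk] := torsion k.
  have -> : `[< ~ f k.+1 `<=` Z >] = false by apply: asboolF; apply.
  by rewrite addn0 leq_b1.
suff -> : `[< ~ F (rann (f k) (f k.+1)) >] = false by rewrite leq_b1.
by apply: asboolF; apply.
Qed.

Lemma bounded_length_extension F K X Y : fbn_ring R ->
  ideal_filter F -> F setT -> extension F K ->
  right_ideal X -> right_ideal Y -> Y `<=` X ->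
  (forall x k, X x -> K k -> Y (x * k)) -> bounded_length F X Y.
Proof.
move=> fR fF FT GK.
elim: GK X Y => {K} [K FK|P cP|I J K GI IHI GJ IHJ iK IJK] X Y iX iY YX XK.
- exact: bounded_length_torsion fF FK XK.
- exact: bounded_length_critical cP iX iY YX XK.
have iJ := (extension_filter fF).1 _ GJ.
have iZ : right_ideal (X `&` lann J Y).
  by apply: right_idealI => //; exact: right_ideal_lann iJ.1 iY.
have ZX : X `&` lann J Y `<=` X by move=> x [].
have YZ : Y `<=` X `&` lann J Y.
  by move=> y Yy; split; [exact: YX|move=> j _; exact: right_idealM].
apply: (bounded_length_trans fF iX iZ ZX YZ).
- apply: IHI => // x i Xx Ii; split; first exact: right_idealM.
  by move=> j Jj; rewrite -mulrA; apply: XK => //; exact: IJK.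
- by apply: IHJ => // x j [_ Zx] Jj; exact: Zx.
Qed.

(** Fitting's argument modulo torsion, for left multiplication by u on R / K. The
    kernels of the powers of u become stationary at some n, and b * j is a
    multiple of u ^+ n modulo K for j in a member of F; since u kills b, it kills
    this multiple, which therefore vanishes. *)
Lemma torsion_kernel F K I (u b : R) : right_noetherian R ->
  ideal_filter F -> F setT -> twosided_ideal K -> F I ->
  (forall i, I i -> exists r, K (i - u * r)) -> K (u * b) ->
  exists2 J, F J & forall j, J j -> K (b * j).
Proof.
move=> rn fF FT iK FI Iu Kub; have [lK rK] := iK.
have [n|n r Kr|n An] := rn (fun n => preimage_mul (u ^+ n) K).
- exact: right_ideal_preimage.
- by rewrite /preimage_mul /= exprS -mulrA; exact: left_idealM.
pose Un m := set_sum (image_mul (u ^+ m) setT) K.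
have iUn m : right_ideal (Un m).
  by apply: right_ideal_sum => //; exact: right_ideal_mul.
have FU m : F (rann setT (Un m)).
  elim: m => [|m FUm].
    apply: filter_sub fF FT (twosided_rann _ (iUn 0%N)) _ => // r _ x _.
    by exists (x * r), 0; rewrite addr0; split=> //; [exists (x * r); rewrite ?mul1r|
      exact: left_ideal0].
  apply: fF.2 FUm (FI) (twosided_rann _ (iUn _)) _ => // r i Ur Ii x _.
  have [_ [k [[m' _ ->] Kk e]]] := Ur x Logic.I.
  have [s Ks] : exists s, K (m' * i - u * s).
    by apply: Iu; exact: left_idealM (fF.1 _ FI).1 Ii.
  exists (u ^+ m.+1 * s), (u ^+ m * (m' * i - u * s) + k * i); split.
  - by exists s.
  - apply: left_idealD => //; [exact: left_idealM|exact: right_idealM].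
  - rewrite mulrA e mulrDl mulrBr exprSr !mulrA addrA; congr (_ + _).
    by rewrite addrC subrK.
exists (rann setT (Un n)) => // j Uj.
have [_ [k [[m _ ->] Kk e]]] := Uj b Logic.I.
rewrite e; apply: left_idealD => //.
suff : preimage_mul (u ^+ n.+1) K m by rewrite (An n.+1 (leqnSn n)).
rewrite /preimage_mul /= exprS -mulrA -(addrK k (u ^+ n * m)) -e mulrBr mulrA.
by apply: right_idealB => //; [exact: right_idealM|exact: left_idealM].
Qed.

End Length.

(** * Factorizations of a central element *)

Section Counting.
Variables (R : pzRingType) (c : R).
Implicit Types (A B C E X Y Z P I J K : set R) (F : set (set R)).

(** Here x lists the successive products by the factors u, all of them divisors of
    c as witnessed by y, and b lists the cofactors of the factors. The sequences
    are infinite; a finite factorization is continued with the factor 1. *)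
Definition bounded_count Y := exists n, forall k (x u b y : nat -> R),
  (forall i, [/\ x i.+1 = x i * u i, u i * b i = c & y i * x i = c]) ->
  (\sum_(i < k) `[< ~ Y (b i) >] <= n)%N.

Definition meet_irreducible Y := forall V1 V2, right_ideal V1 ->
  right_ideal V2 -> Y `<=` V1 -> Y `<=` V2 -> V1 `&` V2 `<=` Y ->
  V1 `<=` Y \/ V2 `<=` Y.

Hypotheses (fR : fbn_ring R) (cc : central c) (c_reg : GRing.lreg c).

(** If b i is not in E, then the step from x i R + T to x i.+1 R + T is not torsion:
    cancelling x i with the help of c, torsion of this step means that u i is onto
    up to torsion on R / K, where K is the annihilator of R / E, while u i kills
    b i modulo K and b i generates a nonzero, hence torsion-free, submodule of
    R / E. *)
Lemma bounded_count_irreducible E : right_ideal E -> E c ->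
  meet_irreducible E -> bounded_count E.
Proof.
move=> iE Ec irrE.
have [rn ln rb lb] := fR.
have iT := @right_ideal_setT R.
have [ET|nET] := pselect (setT `<=` E).
  exists 0%N => k x u b y _; rewrite big1 // => i _.
  suff -> : `[< ~ E (b i) >] = false by [].
  by apply: asboolF; apply; exact: ET.
have icE := right_ideal_mul c iE.
have icT := right_ideal_mul c iT.
have cancelE r : image_mul c E (c * r) -> E r by move=> [s Es /c_reg ->].
(* R / N is an essential extension of cR / cE, a copy of R / E. *)
have [||N [iN cEN NcE] maxN] := noetherian_max rn (F := [set N |
  [/\ right_ideal N, image_mul c E `<=` N
    & N `&` image_mul c setT `<=` image_mul c E]]).
- by exists (image_mul c E); split=> // x [].
- by move=> A [].
have [U [[iU EU _ nU] pP maxP]] :=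
  prime_annihilator rn iE iE iT (@subset_refl _ E) (fun x _ => Logic.I) nET.
set P := rann U E in pP maxP.
have [F [fF FT bF cP]] := critical_filter fR pP.
have [_ nFP _] := cP.
pose T := rann setT N.
have iTT : twosided_ideal T by exact: twosided_rann.
have GT : extension F T.
  have icU := right_ideal_mul c iU.
  have iW := right_ideal_sum icU iN.
  apply: (essential_torsion (W := set_sum (image_mul c U) N) fR
    (extension_filter fF) _ (extension_balanced fR fF FT bF)) => //.
  - exact: extension_base.
  - exact: sub_sumr.
  - move=> D iD ND _ nDN.
    have [r [Dcr nEr]] : exists r, D (c * r) /\ ~ E r.
      apply: contrapT => nr; apply: nDN; apply: maxN => //; split=> //.
        exact: subset_trans ND.
      move=> t [Dt [r _ er]]; rewrite er in Dt *; exists r => //.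
      by apply: contrapT => nEr; apply: nr; exists r.
    pose V := preimage_mul c D.
    have : ~ V `&` U `<=` E.
      move=> /(irrE V U)[] //; first exact: right_ideal_preimage.
      + by move=> e Ee; apply: ND; apply: cEN; exists e.
      + by move=> VE; apply: nEr; exact: VE.
    move=> /not_subsetP[t [Vt Ut] nEt].
    exists (c * t); split=> //.
      by apply: sub_suml => //; exists t.
    by move=> Nct; apply/nEt/cancelE/NcE; split=> //; exists t.
  - apply: filter_sub (extension_filter fF) (extension_critical cP) _ _.
      exact: twosided_rann.
    move=> p Pp _ [_ [n [[v Uv ->] Nn ->]]]; rewrite mulrDl -mulrA.
    apply: right_idealD => //; last exact: right_idealM.
    by apply: cEN; exists (v * p) => //; exact: Pp.
have [n bn] : bounded_length F setT T.
  apply: (bounded_length_extension fR fF FT GT) => //; first exact: iTT.2.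
  by move=> x t _ Tt; exact: left_idealM iTT.1 Tt.
exists n => k x u b y H.
pose f i := set_sum (image_mul (x i) setT) T.
have fi i : right_ideal (f i).
  by apply: right_ideal_sum iTT.2; exact: right_ideal_mul.
apply: leq_trans (bn k f fi _ _).
- apply: leq_sum => i _; have [xS ub yx] := H i.
  have [Eb|nEb] := pselect (E (b i)).
    by rewrite asboolF //; apply.
  rewrite [X in (_ <= nat_of_bool X)%N]asboolT ?leq_b1 // => FI.
  pose K := rann setT E.
  have iK : twosided_ideal K by exact: twosided_rann.
  have [||J FJ bJ] := torsion_kernel (u := u i) (b := b i) rn fF FT iK FI.
  + move=> r Ir.
    have [|_ [t [[s _ ->] Tt e]]] := Ir (x i).
      by apply: sub_suml iTT.2 _ _; exists 1; rewrite ?mulr1.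
    exists s => z _; apply: cancelE; apply: NcE; split;
      last by exists (z * (r - u i * s)).
    rewrite mulrA cc -mulrA; suff : T (c * (r - u i * s)) by apply.
    rewrite -yx -mulrA mulrBr e xS mulrA addrAC subrr add0r.
    exact: left_idealM iTT.1 Tt.
  + by move=> z _; rewrite ub -cc; exact: right_idealM.
  pose V := set_sum (image_mul (b i) setT) E.
  have iV : right_ideal V by apply: right_ideal_sum => //; exact: right_ideal_mul.
  have EV : E `<=` V by apply: sub_sumr; exact: right_ideal_mul.
  have : ~ V `&` U `<=` E.
    move=> /(irrE V U)[] // VE; apply: nEb; apply: VE.
    by apply: sub_suml => //; exists 1; rewrite ?mulr1.
  move=> /not_subsetP[t [Vt Ut] nEt].
  have VJ v j : V v -> J j -> E (v * j).
    move=> [_ [e [[s _ ->] Ee ->]]] Jj; rewrite mulrDl.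
    apply: right_idealD => //; last exact: right_idealM.
    have Jsj : J (s * j) by exact: left_idealM (fF.1 _ FJ).1 Jj.
    by have := bJ _ Jsj 1 Logic.I; rewrite mul1r mulrA.
  apply: nFP; apply: filter_sub fF (FJ) _ _; first by case: pP.
  apply: subset_trans (maxP (V `&` U) _ _ _ _).
  + by move=> j Jj v [Vv _]; exact: VJ.
  + exact: right_idealI.
  + by move=> e Ee; split; [exact: EV|exact: EU].
  + by move=> v [].
  + by move=> VU; apply: nEt; apply: VU.
- move=> i; rewrite {1}/f; have [-> _ _] := H i; apply: sum_sub => //; last first.
    by apply: sub_sumr; exact: right_ideal_mul.
  move=> _ [r _ ->]; apply: sub_suml iTT.2 _ _.
  by exists (u i * r); rewrite ?mulrA.
- by move=> i; split=> //; apply: sub_sumr; exact: right_ideal_mul.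
Qed.

(** Noetherian induction: for Y the intersection of two larger right ideals, the
    bound for Y is the sum of their bounds. *)
Lemma bounded_count_right_ideal Y : right_ideal Y -> Y c -> bounded_count Y.
Proof.
move=> iY Yc; apply: contrapT => nY.
have [||Z [iZ Zc nZ] maxZ] := noetherian_max (fbn_right_noetherian fR)
  (F := [set Z | [/\ right_ideal Z, Z c & ~ bounded_count Z]]).
- by exists Y.
- by move=> A [].
apply: (nZ); apply: bounded_count_irreducible => // V1 V2 iV1 iV2 ZV1 ZV2 V12.
apply: contrapT => /not_orP[nV1 nV2].
have bV V : right_ideal V -> Z `<=` V -> ~ V `<=` Z -> bounded_count V.
  move=> iV ZV nV; apply: contrapT => nbV; apply: nV; apply: maxZ => //.
  by split=> //; exact: ZV.
have [n1 b1] := bV _ iV1 ZV1 nV1; have [n2 b2] := bV _ iV2 ZV2 nV2.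
apply: nZ; exists (n1 + n2)%N => k x u b y H.
apply: leq_trans (leq_add (b1 k _ _ _ _ H) (b2 k _ _ _ _ H)).
rewrite -big_split /=; apply: leq_sum => i _.
have [Vb1|nVb1] := pselect (V1 (b i));
  last by rewrite (asboolT nVb1); exact: leq_trans (leq_b1 _) (leq_addr _ _).
have [Vb2|nVb2] := pselect (V2 (b i));
  last by rewrite (asboolT nVb2); exact: leq_trans (leq_b1 _) (leq_addl _ _).
by rewrite asboolF //; apply; apply: V12.
Qed.

End Counting.

(** * Central multiples and bounded factorizations *)

(** If V meets aR trivially, then V, aV, a^2 V and so on are independent, and the
    ascending chain S of their partial sums can only stop if V = 0. *)
Lemma regular_essential (R : pzRingType) (a : R) : right_noetherian R ->
  GRing.lreg a -> essential [set 0] (image_mul a setT) setT.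
Proof.
move=> rn a_reg V iV _ _ nV; apply: contrapT => noe.
have Va v r : V v -> v = a * r -> v = 0.
  by move=> Vv e; apply: contrapT => v0; apply: noe; exists v; split=> //; exists r.
pose S n := iter n (fun A => set_sum V (image_mul a A)) [set 0].
have iS n : right_ideal (S n).
  elim: n => [|n IH] /=; first exact: right_ideal_zero.
  by apply: right_ideal_sum => //; exact: right_ideal_mul.
have SS n : S n `<=` S n.+1.
  elim: n => [|n IH] x; first by move=> ->; exact: right_ideal0 (iS 1%N).
  move=> [v [_ [Vv [s Ss ->] ->]]]; exists v, (a * s); split=> //.
  by exists s => //; exact: IH.
have [N /(_ N.+1 (leqnSn N)) SN] := rn S iS SS.
have {}SN : S N.+1 `<=` S N by rewrite SN.
have down n : S n.+2 `<=` S n.+1 -> S n.+1 `<=` S n.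
  move=> Sn s Ss; have [|v [_ [Vv [t St ->] e]]] := Sn (a * s).
    exists 0, (a * s); rewrite add0r; split=> //; first exact: right_ideal0.
    by exists s.
  have v0 : v = 0.
    by apply: (Va v (s - t)) => //; rewrite mulrBr e addrK.
  by move: e; rewrite v0 add0r => /a_reg ->.
have S10 : S 1%N `<=` [set 0].
  by elim: N SN => // N IH /down.
by apply: nV; apply: subset_trans S10; apply: sub_suml; exact: right_ideal_mul (iS 0%N).
Qed.

(** For z central, zR and the annihilator of z are two-sided ideals with zero
    product. *)
Lemma central_regular (R : pzRingType) (z : R) : prime_ring R -> central z ->
  z <> 0 -> GRing.lreg z.
Proof.
move=> [_ _ pR] cz z0.
have iz := right_ideal_mul z (@right_ideal_setT R).
have tz : twosided_ideal (image_mul z setT).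
  split=> //; split=> [|x y|x r [s _ ->]].
  - exact: right_ideal0.
  - exact: right_idealD.
  - by exists (r * s); rewrite // !mulrA (cz r).
have tA : twosided_ideal (rann (image_mul z setT) [set 0]).
  exact: twosided_rann iz (@right_ideal_zero R).
have kill r : z * r = 0 -> r = 0.
  move=> zr; have [|zz|Az] := pR _ _ tz tA.
  - by move=> x y zx /(_ x zx).
  - by case: z0; apply: zz; exists 1; rewrite ?mulr1.
  - apply: Az => _ [s _ ->]; rewrite /= (cz s) -mulrA zr mulr0 //.
by move=> x y zxy; apply/subr0_eq/kill; rewrite mulrBr zxy subrr.
Qed.

Lemma central_multiple (R : pzRingType) (a : R) : prime_ring R -> fbn_ring R ->
  (forall I : set R, twosided_ideal I -> I <> [set 0] ->
     exists z : R, [/\ I z, z <> 0 & central z]) ->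
  GRing.lreg a -> exists b, central (a * b) /\ a * b <> 0.
Proof.
move=> pR fR zR a_reg; have [rn _ rb _] := fR.
have [|J [iJ _ nJ Ja]] :=
  rb _ pR _ (right_ideal_mul a (@right_ideal_setT R)) _ (regular_essential rn a_reg).
  by move=> _ ->; exists 0; rewrite ?mulr0.
have [|z [Jz z0 cz]] := zR J iJ; first by move=> J0; apply: nJ; rewrite J0.
by have [b _ zab] := Ja z Jz; exists b; rewrite -zab.
Qed.

Definition nonunit_factorization (R : pzRingType) (a : R) (s : seq R) :=
  (forall u, u \in s -> cancellative u /\ ~ is_unit u) /\
  a = \prod_(u <- s) u.

(** A factorization of a is continued to one of a central multiple c = a * b0. The
    cofactor of a nonunit factor is not in cR, so the count for cR bounds the
    number of factors. *)
Lemma bounded_nonunit_factorization (R : pzRingType) (a : R) :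
  prime_ring R -> fbn_ring R ->
  (forall I : set R, twosided_ideal I -> I <> [set 0] ->
     exists z : R, [/\ I z, z <> 0 & central z]) ->
  cancellative a ->
  exists n, forall s, nonunit_factorization a s -> (size s <= n)%N.
Proof.
move=> pR fR zR [a_reg _].
have [b0 [cc c0]] := central_multiple pR fR zR a_reg.
set c := a * b0 in cc c0.
have c_reg := central_regular pR cc c0.
have [|n bn] := bounded_count_right_ideal fR cc c_reg
  (right_ideal_mul c (@right_ideal_setT R)); first by exists 1; rewrite ?mulr1.
exists n => s [sP a_prod].
(* Beyond the end of s the factor u i is 1 and x i is a. *)
pose x i := \prod_(v <- take i s) v.
pose u i := nth 1 s i.
pose w i := (\prod_(v <- drop i.+1 s) v) * b0.
have xS i : x i.+1 = x i * u i.
  rewrite /x /u; have [si|si] := leqP (size s) i.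
    by rewrite !take_oversize ?nth_default ?mulr1 // leqW.
  by rewrite (take_nth 1 si) -cats1 big_cat big_seq1.
have x_reg i : GRing.lreg (x i).
  rewrite /x big_seq; apply: big_ind => [|v v'|v /mem_take /sP[[]]] //.
    exact: GRing.lreg1.
  exact: GRing.lregM.
have xuw i : x i * (u i * w i) = c.
  by rewrite mulrA -xS /x /w mulrA -big_cat cat_take_drop -a_prod.
have H i : [/\ x i.+1 = x i * u i, u i * (w i * x i) = c & u i * w i * x i = c].
  have e : u i * w i * x i = c by apply: (x_reg i); rewrite mulrA xuw cc.
  by split=> //; rewrite mulrA.
apply: leq_trans (bn (size s) x u (fun i => w i * x i) (fun i => u i * w i) H).
rewrite -[X in (X <= _)%N]card_ord -sum1_card; apply: leq_sum => i _.
rewrite asboolT // => -[r _ e].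
have [[u_reg _] nu] := sP _ (mem_nth 1 (ltn_ord i)).
have ur : u i * r = 1.
  by apply: c_reg; rewrite mulrA cc -mulrA -e mulr1; have [] := H i.
apply: nu; exists r; split=> //.
by apply: u_reg; rewrite mulrA ur mul1r mulr1.
Qed.

(** A bound on the number of nonunit factors also forces atomicity: if a nonunit
    splits into two nonunits, then both inherit a smaller bound. *)
Lemma BF_ring_bounded (R : pzRingType) :
  (forall a : R, cancellative a ->
     exists n, forall s, nonunit_factorization a s -> (size s <= n)%N) ->
  BF_ring R.
Proof.
move=> bR; split=> a ca; last first.
  have [n bn] := bR a ca; exists n => s [sP a_prod]; apply: bn; split=> // u.
  by move=> /sP[].
move=> nu; have [n bn] := bR a ca.
elim: n a ca nu bn => [|n IH] a ca nu bn.
  suff /bn : nonunit_factorization a [:: a] by [].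
  by split=> [u|]; rewrite ?big_seq1 // inE => /eqP ->.
have [aa|na] := pselect (atom a).
  by exists [:: a]; split=> [u|]; rewrite ?big_seq1 // inE => /eqP ->.
have [b [d [cb cd e nb nd]]] : exists b d,
    [/\ cancellative b, cancellative d, a = b * d, ~ is_unit b & ~ is_unit d].
  apply: contrapT => nbd; apply: na; split=> // b d cb cd e.
  by apply: contrapT => /not_orP[nb nd]; apply: nbd; exists b, d.
have [|s [sP b_prod]] := IH b cb nb.
  move=> s [sP b_prod]; have := bn (rcons s d); rewrite size_rcons; apply; split.
    by move=> u; rewrite mem_rcons inE => /orP[/eqP ->|/sP].
  by rewrite -cats1 big_cat big_seq1 -b_prod.
have [|t [tP d_prod]] := IH d cd nd.
  move=> t [tP d_prod]; have := bn (b :: t); apply; split.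
    by move=> u; rewrite inE => /orP[/eqP ->|/tP].
  by rewrite big_cons -d_prod.
exists (s ++ t); split; last by rewrite big_cat -b_prod -d_prod.
by move=> u; rewrite mem_cat => /orP[/sP|/tP].
Qed.

Theorem theorem4p10 (R : pzRingType) (R_prime : prime_ring R) (R_FBN : FBN R)
    (R_central : forall I : set R, twosided_ideal I -> I <> [set 0] ->
       exists z : R, [/\ I z, z <> 0 & central z]) :
  BF_ring R.
Proof.
apply: BF_ring_bounded => a ca; apply: bounded_nonunit_factorization => //.
exact: FBN_fbn_ring.
Qed.
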